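(* Let $H$ be a bounded graph with vertices $a,b$, let $n\ge1$, and let $X_n$ be the blow-up of $n$ copies of $H$. For every real $\tau$, the following are equivalent: (1) perfect state transfer occurs between vertices $a$ and $b$ in $H$ at time $\tau$; (2) perfect state transfer occurs between $\sum_{j=0}^{n-1}\mathbf e_{(j,a)}$ and $\sum_{j=0}^{n-1}\mathbf e_{(j,b)}$ in $X_n$ at time $\frac{\tau}{n}$; in particular, perfect state transfer occurs between $\frac1{\sqrt2}(\mathbf e_{(0,a)}+\mathbf e_{(1,a)})$ and $\frac1{\sqrt2}(\mathbf e_{(0,b)}+\mathbf e_{(1,b)})$ in $X_2$ at time $\frac{\tau}{2}$; (3) for a diagonal matrix $D$ with $\pm1$ diagonal entries such that $D_{(0,a)}=-D_{(1,a)}$ and $D_{(0,b)}=-D_{(1,b)}$, the signed graph $\tilde X_2$ with $A(\tilde X_2)=DA(X_2)D$ has perfect state transfer between $\frac1{\sqrt2}(\mathbf e_{(0,a)}-\mathbf e_{(1,a)})$ and $\frac1{\sqrt2}(\mathbf e_{(0,b)}-\mathbf e_{(1,b)})$ at time $\frac{\tau}{2}$; (4) for a diagonal matrix $D$ with $\pm1$ diagonal entries such that $D_{(0,a)}=-D_{(1,a)}$ and $D_{(0,b)}=D_{(1,b)}$, the signed graph $\tilde X_2$ with $A(\tilde X_2)=DA(X_2)D$ has perfect state transfer between $\frac1{\sqrt2}(\mathbf e_{(0,a)}-\mathbf e_{(1,a)})$ and $\frac1{\sqrt2}(\mathbf e_{(0,b)}+\mathbf e_{(1,b)})$ at time $\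frac{\tau}{2}$.
   Context: A graph has a countable vertex set and symmetric real edge weights $w(a,b)$ ($w(a,b)\neq0$ iff $\{a,b\}$ is an edge); it is bounded if $\sum_b|w(a,b)|^2<\infty$ for each $a$ and the absolute degrees $\sum_b|w(a,b)|$ are uniformly bounded. $A(G)_{a,b}=w(a,b)$, $U_G(t)=\exp(itA(G))$, and there is perfect state transfer between unit vectors (or nonzero vectors, after normalization) $\mathbf u,\mathbf v$ at $\tau$ if $U_G(\tau)\mathbf u=\gamma\mathbf v$ for some $\gamma\in\mathbb C$. With $\mathbb Z_n=\{0,\dots,n-1\}$ and $J_n$ the $n\times n$ all-ones matrix, the blow-up $X_n$ of $n$ copies of $H$ has vertex set $\mathbb Z_n\times V(H)$ and adjacency matrix $J_n\otimes A(H)$. $\mathbf e_{(j,a)}$ denotes the standard basis vector of vertex $(j,a)$.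
   Formalization: The equivalence with (4) is stated only for a ≠ b: if a = b the two conditions on D in (4) contradict each other, so no such D exists and (4) cannot be equivalent to (1) (e.g. at τ = 0); (1)–(3) are stated for all a, b. *)

(* Defs.v *)
From HB Require Import structures.
From mathcomp Require Import all_boot all_order all_algebra.
From mathcomp Require Import all_classical all_reals all_analysis.
From mathcomp Require Import complex.
From mathcomp.analysis.showcase Require summability.

Set Implicit Arguments.
Unset Strict Implicit.
Unset Printing Implicit Defensive.

Import Order.TTheory GRing.Theory Num.Theory numFieldNormedType.Exports.

Local Open Scope classical_set_scope.
Local Open Scope ring_scope.
Local Open Scope complex_scope.

Section InfiniteMatrices.
Variables (R : realType) (V : countType).
Implicit Types (M N E : V -> V -> R[i]) (u v : V -> R[i]).

(* Sum of a countable family as the limit along the finite subsets of V; since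
   R[i] carries no topology, real and imaginary parts are summed separately. *)
Definition csum (f : V -> R[i]) : R[i] :=
  summability.sum (fun x => complex.Re (f x) : R)
  +i* summability.sum (fun x => complex.Im (f x) : R).

Lemma sum_single (f : V -> R) (x : V) :
  (forall y, y != x -> f y = 0) -> summability.sum f = f x.
Proof.
move=> fx; have ? := @summability.totally_filter V.
apply: (@lim_near_cst R) => //; exists (finmap.fset1 x) => // B /= xB.
rewrite /summability.partial_sum -(finmap.big_seq_fsetE _ B xpredT f).
rewrite -(finmap.big_fset_incl _ xB) ?finmap.big_seq_fset1// => y _ yx.
by apply: fx; apply: contra yx => /eqP ->; rewrite finmap.fset11.
Qed.

Lemma csum_single (f : V -> R[i]) (x : V) :
  (forall y, y != x -> f y = 0) -> csum f = f x.
Proof.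
move=> fx; rewrite /csum (@sum_single _ x) ?(@sum_single _ x) => [|y yx|y yx].
- by case: (f x).
- by rewrite fx.
- by rewrite fx.
Qed.

Definition mxact M u : V -> R[i] := fun x => csum (fun y => M x y * u y).

Definition mxmult M N : V -> V -> R[i] :=
  fun x z => csum (fun y => M x y * N y z).

Definition mxdiag (d : V -> R) : V -> V -> R[i] :=
  fun x y => (d x *+ (x == y))%:C.

Definition mxpow M (k : nat) : V -> V -> R[i] :=
  iter k (mxmult M) (mxdiag (fun=> 1)).

Definition l2norm u : \bar R :=
  sqrte (\esum_(x in [set: V]) (ComplexField.Normc.normc (u x) ^+ 2)%:E).

Definition opnorm M : \bar R :=
  ereal_sup [set l2norm (mxact M u) | u in [set u | (l2norm u <= 1)%E]].

Definition is_expmx M E : Prop :=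
  opnorm (fun x y => \sum_(k < m) (k`!%:R)^-1 * mxpow M k x y - E x y)
    @[m --> \oo] --> 0%E.

(* When M is the matrix of a bounded operator on l2(V), the matrix E with
   [is_expmx M E] exists and is unique; 0 is only a default value otherwise. *)
Definition expmx M : V -> V -> R[i] :=
  xget (fun _ _ => 0) [set E | is_expmx M E].

Definition ket (a : V) : V -> R[i] := fun x => (x == a)%:R.

Definition normalize u : V -> R[i] := (fine (l2norm u))^-1%:C *: u.

End InfiniteMatrices.

(* {x, y} is an edge iff [weight x y != 0]; loops are not excluded. *)
Record wgraph (R : realType) (V : countType) := WGraph {
  weight : V -> V -> R;
  weight_sym : forall x y, weight x y = weight y x }.

Section Graphs.
Variables (R : realType) (V : countType).
Implicit Types (G : wgraph R V) (u v : V -> R[i]) (d : V -> R).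

Definition bounded_graph G : Prop :=
  (forall x, (\esum_(y in [set: V]) (`|weight G x y| ^+ 2)%:E < +oo)%E) /\
  exists K : R, forall x,
    (\esum_(y in [set: V]) `|weight G x y|%:E <= K%:E)%E.

Definition adjmx G : V -> V -> R[i] := fun x y => (weight G x y)%:C.

Definition transition G (t : R) : V -> V -> R[i] :=
  expmx (fun x y => (0 +i* t) * adjmx G x y).

(* For nonzero u and v in l2(V); unit vectors are their own normalization, and
   g is forced to have modulus 1 because the transition matrix is unitary. *)
Definition pst G (t : R) u v : Prop :=
  exists g : R[i], mxact (transition G t) (normalize u) = g *: normalize v.

Fact blowup_sym n G (p q : 'I_n * V) :
  (const_mx 1 : 'M[R]_n) p.1 q.1 * weight G p.2 q.2 =
  (const_mx 1 : 'M[R]_n) q.1 p.1 * weight G q.2 p.2.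
Proof. by rewrite !mxE (weight_sym G p.2). Qed.

(* The adjacency matrix is the Kronecker product of J_n and A(G). *)
Definition blowup n G : wgraph R ('I_n * V)%type := WGraph (@blowup_sym n G).

Definition signing d : Prop := forall x, d x = 1 \/ d x = -1.

Fact signed_sym d G x y :
  d x * weight G x y * d y = d y * weight G y x * d x.
Proof. by rewrite (weight_sym G x) mulrAC -mulrA mulrC -mulrA mulrCA mulrA. Qed.

(* The weights are the entries of D A(G) D, for D the diagonal matrix d;
   see [adjmx_signed]. *)
Definition signed d G : wgraph R V := WGraph (signed_sym d G).

Lemma adjmx_signed d G :
  adjmx (signed d G) = mxmult (mxmult (mxdiag d) (adjmx G)) (mxdiag d).
Proof.
apply/funext => x; apply/funext => y; rewrite /mxmult (csum_single (x := y)).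
  rewrite (csum_single (x := x)) /mxdiag/adjmx /= ?eqxx -?rmorphM //= => z zx.
  by rewrite eq_sym (negbTE zx) mulr0n mul0r.
by move=> z zy; rewrite /mxdiag (negbTE zy) mulr0n mulr0.
Qed.

End Graphs.

(* Main.v *)
(* Put A = A(H).  Since (J_n (x) A) (1 (x) u) = n 1 (x) (A u), the walk of X_n
   at time tau / n acts on the vectors 1 (x) u as the walk of H at time tau.  In
   X_2, a switching D maps each minus state to plus or minus a plus state, and
   exp(i t D A D) = D exp(i t A) D.  For infinite matrices, bounds on absolute
   row and column sums pass to products and to the exponential series, whose
   convergence in operator norm is then the Schur test; on finitely supported u
   this makes exp(i t A) u the entrywise limit of the partial sums of
   (i t A)^k u / k!, so that it is enough to compare powers. *)
Require Import Defs.
From mathcomp Require Import all_boot all_order all_algebra finmap.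
From mathcomp Require Import all_classical all_reals all_analysis.
From mathcomp Require Import complex lra ring.

Set Implicit Arguments.
Unset Strict Implicit.
Unset Printing Implicit Defensive.

Import Order.TTheory GRing.Theory Num.Theory.
Import numFieldNormedType.Exports.

Local Open Scope ring_scope.
Local Open Scope complex_scope.

(** * Countable sums *)

Section ExtendedSums.
Local Open Scope classical_set_scope.
Variable R : realType.

(** Limits in the definitions are meaningful only where they exist, and [expmx] is merely a choice
    satisfying [is_expmx]. Additivity and scaling of countable sums therefore carry proofs of
    absolute summability, obtained by bounding [norm1] in nonnegative sums [esum], where the order
    of summation can be exchanged freely. A vertex may have infinitely many neighbours, so applying
    the adjacency matrix may destroy finite support. The iterates are instead kept in the class of
    bounded functions, on which matrices with absolutely summable rows act. Iterating this action on
    a vector also replaces any appeal to associativity of infinite matrix products. The constants 2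
    in the operator norm estimates come from comparing [norm1] with the modulus; they are harmless
    because the estimates are only used to show convergence to 0. *)

Lemma esumZl (T : choiceType) (c : R) (f : T -> \bar R) : 0 <= c ->
  (forall i, 0 <= f i)%E ->
  (\esum_(i in [set: T]) (c%:E * f i) = c%:E * \esum_(i in [set: T]) f i)%E.
Proof.
move=> c0 f0; rewrite /esum -ereal_supZl//; last first.
  by apply/set0P; exists (\sum_(x \in set0) f x)%E; exists set0 => //;
     exact: fsets_set0.
rewrite image_comp; congr (ereal_sup _); apply: eq_imagel => A _ /=.
by rewrite ge0_mule_fsumr.
Qed.

(** Tonelli: both iterated sums equal the sum over pairs, and swapping coordinates is a
    bijection. *)
Lemma esum_exchange (T1 T2 : choiceType) (f : T1 -> T2 -> \bar R) :
  (forall i j, 0 <= f i j)%E ->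
  (\esum_(i in [set: T1]) \esum_(j in [set: T2]) f i j =
   \esum_(j in [set: T2]) \esum_(i in [set: T1]) f i j)%E.
Proof.
move=> f0; rewrite !esum_esum//.
rewrite [RHS](reindex_esum ([set: T1] `*`` fun=> [set: T2]) _
  (fun p => (p.2, p.1)))//=; split => //.
- by move=> [i j] [i' j'] _ _ /= [-> ->].
- by move=> [i j] _; exists (j, i).
Qed.

(** The outer sum over the n copies is finite with equal terms; this is the source of the factor n
    in blow-ups. *)
Lemma esum_snd (T : choiceType) n (f : T -> \bar R) :
  (forall i, 0 <= f i)%E ->
  (\esum_(p in [set: 'I_n * T]) f p.2 =
   n%:R%:E * \esum_(i in [set: T]) f i)%E.
Proof.
move=> f0.
have -> : [set: 'I_n * T] = [set: 'I_n] `*`` fun=> [set: T].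
  by apply/seteqP; split.
rewrite -(esum_esum (a := fun _ j => f j))//.
have finI : finite_set [set: 'I_n] by exact: finite_finset.
rewrite esum_fset//; last by move=> *; exact: esum_ge0.
rewrite fsbig_finite//= (perm_big (index_enum 'I_n)); last first.
  apply: uniq_perm; rewrite ?fset_uniq ?index_enum_uniq// => i.
  by rewrite in_fset_set// mem_index_enum mem_set.
by rewrite sumr_const card_ord mule_natl.
Qed.

Lemma esum_single (T : choiceType) (f : T -> \bar R) x :
  (0 <= f x)%E -> (forall y, y != x -> f y = 0%E) ->
  (\esum_(i in [set: T]) f i = f x)%E.
Proof.
move=> fx0 fx; rewrite -[RHS]esum_set1// [RHS]esum_mkcond.
apply: eq_esum => i _; case: ifPn => //; rewrite notin_setE /= => ix.
by apply: fx; apply/eqP.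
Qed.

Lemma esum_ge_term (T : choiceType) (f : T -> \bar R) x :
  (f x <= \esum_(i in [set: T]) f i)%E.
Proof.
by apply: esum_ge; exists [set x]; [split|rewrite fsbig_set1].
Qed.

End ExtendedSums.

(** * Unordered sums of real families *)

Section RealSums.
Local Open Scope classical_set_scope.
Variables (R : realType) (V : countType).
Implicit Types f g : V -> R.
Import summability.

#[local] Existing Instance totally_filter.

Lemma partial_sumE f (B : {fset V}) : partial_sum f B = \sum_(i <- B) f i.
Proof. by rewrite /partial_sum -(big_seq_fsetE _ B xpredT f). Qed.

Lemma esum_fset_le f (B : {fset V}) :
  ((\sum_(i <- B) f i)%:E <= \esum_(i in [set: V]) (f i)%:E)%E.
Proof.
apply: esum_ge; exists [set` B]; first by split.
by rewrite fsbig_finite//= set_fsetK sumEFin.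
Qed.

(** [esum] is a supremum over finite sets: a finite set that comes within e of it does so together
    with all its finite supersets, which is convergence along [totally]. *)
Lemma cvg_partial_sum_ge0 f : (forall x, 0 <= f x) ->
  (\esum_(x in [set: V]) (f x)%:E < +oo)%E ->
  partial_sum f @ totally --> fine (\esum_(x in [set: V]) (f x)%:E).
Proof.
move=> f0 foo; set S := (esum _ _) in foo *.
have Sf : S \is a fin_num.
  by rewrite ge0_fin_numE//; apply: esum_ge0 => x _; rewrite lee_fin.
apply/cvgrPdist_lt => e e0.
have : (S - e%:E < S)%E by rewrite lteBlDr// lteDl// lte_fin.
move=> /ereal_sup_gt[_ [A [finA _] <-]] SA.
exists (fset_set A) => // B /= AB.
have SB : (S - e%:E < (partial_sum f B)%:E)%E.
  apply: (lt_le_trans SA); rewrite partial_sumE -sumEFin.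
  rewrite -[B in leRHS]set_fsetK -fsbig_finite//=.
  apply: lee_fsum_nneg_subset => // [x|x _]; last by rewrite lee_fin.
  by rewrite !inE => Ax; apply: (fsubsetP AB); rewrite in_fset_set// inE.
have BS : ((partial_sum f B)%:E <= S)%E by rewrite partial_sumE esum_fset_le.
move: SB BS; rewrite -(fineK Sf) -EFinB lte_fin lee_fin /= => SB BS.
by rewrite ger0_norm ?subr_ge0//; lra.
Qed.

(** An explicit value for the limit [sum f] of an absolutely summable family; unlike a limit, it
    inherits identities of [esum] such as [esum_snd]. *)
Definition rsum f : R :=
  fine (\esum_(x in [set: V]) (Num.max (f x) 0)%:E) -
  fine (\esum_(x in [set: V]) (Num.max (- f x) 0)%:E).

Lemma max0_ge0 (r : R) : 0 <= Num.max r 0.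
Proof. by rewrite le_max lexx orbT. Qed.

Lemma max0_le_norm (r : R) : Num.max r 0 <= `|r|.
Proof. by rewrite ge_max ler_norm normr_ge0. Qed.

Lemma max0B (r : R) : Num.max r 0 - Num.max (- r) 0 = r.
Proof. by case: (lerP 0 r) => h; case: (lerP 0 (- r)) => h'; lra. Qed.

Lemma max0D (r : R) : Num.max r 0 + Num.max (- r) 0 = `|r|.
Proof.
by case: (lerP 0 r) => h; case: (lerP 0 (- r)) => h';
  rewrite ?(ger0_norm h) ?(ltr0_norm h); lra.
Qed.

Lemma esum_max0_fin_num f :
  (\esum_(x in [set: V]) `|f x|%:E < +oo)%E ->
  (\esum_(x in [set: V]) (Num.max (f x) 0)%:E)%E \is a fin_num.
Proof.
move=> foo; rewrite ge0_fin_numE; last first.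
  by apply: esum_ge0 => x _; rewrite lee_fin max0_ge0.
by apply: le_lt_trans foo; apply: le_esum => x _; rewrite lee_fin max0_le_norm.
Qed.

Lemma abs_summableN_real f :
  (\esum_(x in [set: V]) `|f x|%:E < +oo)%E ->
  (\esum_(x in [set: V]) `|- f x|%:E < +oo)%E.
Proof. by under [in X in _ -> X]eq_esum do rewrite normrN. Qed.

Lemma cvg_partial_sum f :
  (\esum_(x in [set: V]) `|f x|%:E < +oo)%E ->
  partial_sum f @ totally --> rsum f.
Proof.
move=> foo.
have -> : partial_sum f = partial_sum (fun x => Num.max (f x) 0) \-
    partial_sum (fun x => Num.max (- f x) 0).
  apply/funext => B /=; rewrite !partial_sumE -sumrB; apply: eq_bigr => x _.
  by rewrite max0B.
apply: cvgB; apply: cvg_partial_sum_ge0 => [x|]; rewrite ?max0_ge0//.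
- rewrite -ge0_fin_numE ?esum_max0_fin_num//.
  by apply: esum_ge0 => x _; rewrite lee_fin max0_ge0.
- rewrite -ge0_fin_numE ?(esum_max0_fin_num (abs_summableN_real foo))//.
  by apply: esum_ge0 => x _; rewrite lee_fin max0_ge0.
Qed.

Lemma sumE f :
  (\esum_(x in [set: V]) `|f x|%:E < +oo)%E -> sum f = rsum f.
Proof. by move=> /cvg_partial_sum /cvg_lim; apply. Qed.

(** An infinite right side leaves nothing to prove, so the bound is available before summability is
    known and can serve to establish it. *)
Lemma le_norm_sum f :
  (`|sum f|%:E <= \esum_(x in [set: V]) `|f x|%:E)%E.
Proof.
have [foo|] := ltP (\esum_(x in [set: V]) `|f x|%:E)%E +oo%E; last first.
  by rewrite leye_eq => /eqP ->; rewrite leey.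
rewrite (sumE foo).
have -> : (\esum_(x in [set: V]) `|f x|%:E =
    \esum_(x in [set: V]) (Num.max (f x) 0)%:E +
    \esum_(x in [set: V]) (Num.max (- f x) 0)%:E)%E.
  rewrite -esumD; try by move=> x _; rewrite lee_fin max0_ge0.
  by apply: eq_esum => x _; rewrite -EFinD max0D.
set S1 := esum _ _; set S2 := esum _ _.
have S1f : S1 \is a fin_num by exact: esum_max0_fin_num.
have S2f : S2 \is a fin_num.
  by exact: (esum_max0_fin_num (abs_summableN_real foo)).
rewrite /rsum -/S1 -/S2 -(fineK S1f) -(fineK S2f) -EFinD lee_fin /=.
have S1p : 0 <= fine S1.
  by apply: fine_ge0; apply: esum_ge0 => x _; rewrite lee_fin max0_ge0.
have S2p : 0 <= fine S2.
  by apply: fine_ge0; apply: esum_ge0 => x _; rewrite lee_fin max0_ge0.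
by rewrite ler_norml; lra.
Qed.

(** Positive and negative parts are not additive; partial sums are, so the identity is obtained from
    uniqueness of their limit. *)
Lemma rsumD f g :
  (\esum_(x in [set: V]) `|f x|%:E < +oo)%E ->
  (\esum_(x in [set: V]) `|g x|%:E < +oo)%E ->
  rsum (fun x => f x + g x) = rsum f + rsum g.
Proof.
move=> foo goo; 
have h : (partial_sum f \+ partial_sum g) @ totally --> rsum f + rsum g.
  by apply: cvgD; exact: cvg_partial_sum.
rewrite -sumE.
  apply: (@cvg_lim R) => //; apply: cvg_trans h; apply: near_eq_cvg.
  by apply: nearW => B; rewrite /= !partial_sumE big_split.
apply: le_lt_trans (lte_add_pinfty foo goo); rewrite -esumD//.
by apply: le_esum => x _; rewrite -EFinD lee_fin ler_normD.
Qed.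

Lemma rsumZ c f :
  (\esum_(x in [set: V]) `|f x|%:E < +oo)%E ->
  rsum (fun x => c * f x) = c * rsum f.
Proof.
move=> foo; 
have h : (fun B => c * partial_sum f B) @ totally --> c * rsum f.
  by apply: cvgMl_tmp; exact: cvg_partial_sum.
rewrite -sumE.
  apply: (@cvg_lim R) => //; apply: cvg_trans h; apply: near_eq_cvg.
  by apply: nearW => B; rewrite /= !partial_sumE mulr_sumr.
under eq_esum do rewrite normrM EFinM.
rewrite esumZl//; first by rewrite lte_mul_pinfty// ?lee_fin// ge0_fin_numE.
Qed.

End RealSums.

(** Works on the positive and negative parts separately, where [esum_snd] applies, instead of
    following the net of finite subsets of the product. *)
Lemma rsum_snd (R : realType) (V : countType) n (f : V -> R) :
  (\esum_(x in [set: V]) `|f x|%:E < +oo)%E ->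
  rsum (fun p : 'I_n * V => f p.2) = n%:R * rsum f.
Proof.
move=> foo; rewrite /rsum.
rewrite (esum_snd n (f := fun x => (Num.max (f x) 0)%:E)); last first.
  by move=> x; rewrite lee_fin max0_ge0.
rewrite (esum_snd n (f := fun x => (Num.max (- f x) 0)%:E)); last first.
  by move=> x; rewrite lee_fin max0_ge0.
rewrite !fineM ?mulrBr//.
- exact: (esum_max0_fin_num (abs_summableN_real foo)).
- exact: esum_max0_fin_num.
Qed.

(** * Absolutely summable complex families *)

Section ComplexSums.
Local Open Scope classical_set_scope.
Variable R : realType.
Implicit Types z w : R[i].

(* A norm on [R[i]] for which the separate summation of real and imaginary
   parts in [csum] costs no constant. *)
Definition norm1 z : R := `|complex.Re z| + `|complex.Im z|.

Lemma norm1_ge0 z : 0 <= norm1 z.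
Proof. by rewrite addr_ge0. Qed.

Lemma norm10 : norm1 0 = 0.
Proof. by rewrite /norm1 /= normr0 addr0. Qed.

Lemma norm1N z : norm1 (- z) = norm1 z.
Proof. by case: z => a b; rewrite /norm1 /= !normrN. Qed.

Lemma norm1_eq0 z : norm1 z = 0 -> z = 0.
Proof.
case: z => a b; rewrite /norm1 /= => /eqP.
by rewrite paddr_eq0// !normr_eq0 => /andP[/eqP -> /eqP ->].
Qed.

Lemma norm1D z w : norm1 (z + w) <= norm1 z + norm1 w.
Proof.
case: z => a b; case: w => c d; rewrite /norm1 /=.
by have := ler_normD a c; have := ler_normD b d; lra.
Qed.

Lemma norm1M z w : norm1 (z * w) <= norm1 z * norm1 w.
Proof.
case: z => a b; case: w => c d; rewrite /norm1 /=.
have := ler_normB (a * c) (b * d); have := ler_normD (a * d) (b * c).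
by rewrite !normrM mulrDl !mulrDr; lra.
Qed.

Lemma norm1_real (a : R) : norm1 a%:C = `|a|.
Proof. by rewrite /norm1 /= normr0 addr0. Qed.

(** With x and y the absolute values of the two parts, this is
    [x^2 + y^2 <= (x + y)^2 <= 2 (x^2 + y^2)]. *)
Lemma norm1_normc z :
  ComplexField.Normc.normc z ^+ 2 <= norm1 z ^+ 2 /\
  norm1 z ^+ 2 <= 2 * ComplexField.Normc.normc z ^+ 2.
Proof.
case: z => a b; rewrite /norm1 /= sqr_sqrtr ?addr_ge0 ?sqr_ge0//.
rewrite -[a ^+ 2]real_normK ?num_real// -[b ^+ 2]real_normK ?num_real//.
have := normr_ge0 a; have := normr_ge0 b; move: `|a| `|b| => x y x0 y0.
by have := sqr_ge0 (x - y); split; nra.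
Qed.

Variable V : countType.
Implicit Types f g : V -> R[i].

Definition abs_summable f : Prop :=
  (\esum_(x in [set: V]) (norm1 (f x))%:E < +oo)%E.

Lemma abs_summable_le f (g : V -> R) :
  (forall x, norm1 (f x) <= g x) ->
  (\esum_(x in [set: V]) (g x)%:E < +oo)%E -> abs_summable f.
Proof.
by move=> fg; apply: le_lt_trans; apply: le_esum => x _; rewrite lee_fin.
Qed.

Lemma abs_summableD f g :
  abs_summable f -> abs_summable g -> abs_summable (fun x => f x + g x).
Proof.
move=> fs gs; apply: (@abs_summable_le _ (fun x => norm1 (f x) + norm1 (g x))).
  by move=> x; exact: norm1D.
under eq_esum do rewrite EFinD.
by rewrite esumD ?lte_add_pinfty// => x _; rewrite lee_fin norm1_ge0.
Qed.

Lemma abs_summableZ c f : abs_summable f -> abs_summable (fun x => c * f x).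
Proof.
move=> fs; apply: (@abs_summable_le _ (fun x => norm1 c * norm1 (f x))).
  by move=> x; exact: norm1M.
under eq_esum do rewrite EFinM.
rewrite esumZl ?norm1_ge0//; last by move=> x; rewrite lee_fin norm1_ge0.
rewrite lte_mul_pinfty ?lee_fin ?norm1_ge0//.
Qed.

Lemma abs_summable_single f x :
  (forall y, y != x -> f y = 0) -> abs_summable f.
Proof.
move=> fx; rewrite /abs_summable (@esum_single _ _ _ x) ?ltry ?lee_fin ?norm1_ge0//.
by move=> y /fx ->; rewrite norm10.
Qed.

Lemma abs_summable_Re f : abs_summable f ->
  (\esum_(x in [set: V]) `|complex.Re (f x)|%:E < +oo)%E.
Proof.
apply: le_lt_trans; apply: le_esum => x _.
by rewrite lee_fin /norm1 lerDl.
Qed.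

Lemma abs_summable_Im f : abs_summable f ->
  (\esum_(x in [set: V]) `|complex.Im (f x)|%:E < +oo)%E.
Proof.
apply: le_lt_trans; apply: le_esum => x _.
by rewrite lee_fin /norm1 lerDr.
Qed.

Lemma csumE f : abs_summable f ->
  csum f = rsum (fun x => complex.Re (f x)) +i* rsum (fun x => complex.Im (f x)).
Proof.
by move=> fs; rewrite /csum !sumE//; [exact: abs_summable_Im|exact: abs_summable_Re].
Qed.

Lemma csumD f g : abs_summable f -> abs_summable g ->
  csum (fun x => f x + g x) = csum f + csum g.
Proof.
move=> fs gs; rewrite !csumE//; last exact: abs_summableD.
have ReD z w : complex.Re (z + w) = complex.Re z + complex.Re w by case: z; case: w.
have ImD z w : complex.Im (z + w) = complex.Im z + complex.Im w by case: z; case: w.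
have -> := funext (fun x => ReD (f x) (g x)).
have -> := funext (fun x => ImD (f x) (g x)).
rewrite (rsumD (abs_summable_Re fs) (abs_summable_Re gs)).
by rewrite (rsumD (abs_summable_Im fs) (abs_summable_Im gs)).
Qed.

(** A complex scalar mixes the two parts that [csum] sums separately, so the four real products are
    summed individually and recombined. *)
Lemma csumZ c f : abs_summable f -> csum (fun x => c * f x) = c * csum f.
Proof.
move=> fs; rewrite !csumE//; last exact: abs_summableZ.
have fr := abs_summable_Re fs; have fi := abs_summable_Im fs.
have Zoo (r : R) (h : V -> R) : (\esum_(x in [set: V]) `|h x|%:E < +oo)%E ->
    (\esum_(x in [set: V]) `|r * h x|%:E < +oo)%E.
  move=> hoo; under eq_esum do rewrite normrM EFinM.
  by rewrite esumZl ?lte_mul_pinfty ?lee_fin.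
case: c => a b.
have ReM z : complex.Re ((a +i* b) * z) = a * complex.Re z + (- b) * complex.Im z.
  by case: z => c d /=; rewrite mulNr.
have ImM z : complex.Im ((a +i* b) * z) = a * complex.Im z + b * complex.Re z.
  by case: z.
have -> := funext (fun x => ReM (f x)).
have -> := funext (fun x => ImM (f x)).
rewrite (rsumD (Zoo a _ fr) (Zoo (- b) _ fi)) (rsumD (Zoo a _ fi) (Zoo b _ fr)).
by rewrite (rsumZ a fr) (rsumZ a fi) (rsumZ b fr) (rsumZ (- b) fi) mulNr.
Qed.

Lemma csum0 : csum (fun _ : V => 0 : R[i]) = 0.
Proof.
have s0 : abs_summable (fun=> 0).
  by rewrite /abs_summable esum1// => x _; rewrite norm10.
have e : (fun=> 0 * 0) = (fun=> 0) :> (V -> R[i]) by apply/funext => x; exact: mul0r.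
by have := csumZ 0 s0; rewrite e => ->; exact: mul0r.
Qed.

Lemma csum_sum (I : Type) (r : seq I) (F : I -> V -> R[i]) :
  (forall i, abs_summable (F i)) ->
  abs_summable (fun x => \sum_(i <- r) F i x) /\
  csum (fun x => \sum_(i <- r) F i x) = \sum_(i <- r) csum (F i).
Proof.
move=> Fs; elim: r => [|i r [IHs IH]].
  under eq_fun do rewrite big_nil.
  rewrite big_nil csum0; split => //.
  by rewrite /abs_summable esum1// => x _; rewrite norm10.
under eq_fun do rewrite big_cons.
by rewrite big_cons csumD// IH; split => //; exact: abs_summableD.
Qed.

Lemma le_norm1_csum f :
  ((norm1 (csum f))%:E <= \esum_(x in [set: V]) (norm1 (f x))%:E)%E.
Proof.
under eq_esum do rewrite EFinD.
by rewrite esumD// /norm1 EFinD leeD// le_norm_sum.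
Qed.

End ComplexSums.

Lemma csum_snd (R : realType) (V : countType) n (f : V -> R[i]) : abs_summable f ->
  abs_summable (fun p : 'I_n * V => f p.2) /\
  csum (fun p : 'I_n * V => f p.2) = n%:R * csum f.
Proof.
move=> fs.
have snds : abs_summable (fun p : 'I_n * V => f p.2).
  rewrite /abs_summable (esum_snd n (f := fun x => (norm1 (f x))%:E)).
    by rewrite lte_mul_pinfty ?lee_fin.
  by move=> x; rewrite lee_fin norm1_ge0.
split=> //; rewrite !csumE//.
rewrite (rsum_snd n (abs_summable_Re fs)) (rsum_snd n (abs_summable_Im fs)).
have MnE (a b : R) m : (a +i* b) *+ m = (a *+ m) +i* (b *+ m) :> R[i].
  by elim: m => // m IH; rewrite !mulrS IH.
by rewrite !mulr_natl MnE.
Qed.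

(** * The Schur test and the matrix exponential *)

Section SchurTest.
Local Open Scope classical_set_scope.
Variable R : realType.

(** After exchanging the sums, each inner sum over j contributes at most L. With a row or column of
    a matrix as weights it bounds products; with squared vector entries it is the last step of the
    Schur test. *)
Lemma esum_kernel_le (T1 T2 : choiceType) (a : T1 -> R) (B : T1 -> T2 -> R) K L :
  (forall i, 0 <= a i) -> (forall i j, 0 <= B i j) -> 0 <= L ->
  (\esum_(i in [set: T1]) (a i)%:E <= K%:E)%E ->
  (forall i, \esum_(j in [set: T2]) (B i j)%:E <= L%:E)%E ->
  (\esum_(j in [set: T2]) \esum_(i in [set: T1]) (a i * B i j)%:E <= (L * K)%:E)%E.
Proof.
move=> a0 B0 L0 aK BL; rewrite esum_exchange; last first.
  by move=> i j; rewrite lee_fin mulr_ge0.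
apply: (@le_trans _ _ (\esum_(i in [set: T1]) (L%:E * (a i)%:E))%E).
  apply: le_esum => i _; under eq_esum do rewrite EFinM.
  rewrite esumZl// => [|j]; last by rewrite lee_fin.
  by rewrite muleC lee_wpmul2r ?lee_fin.
rewrite esumZl//.
by rewrite EFinM lee_wpmul2l ?lee_fin.
Qed.

Variable V : countType.
Implicit Types (M N : V -> V -> R[i]) (u : V -> R[i]).

(** Row sums control the action on bounded functions and column sums the action on summable ones;
    the Schur test combines them on square-summable vectors. *)
Definition schur_bounded M (K : R) : Prop :=
  [/\ 0 <= K, forall x, (\esum_(y in [set: V]) (norm1 (M x y))%:E <= K%:E)%E
    & forall y, (\esum_(x in [set: V]) (norm1 (M x y))%:E <= K%:E)%E].

Lemma schur_bounded_entry M K x y : schur_bounded M K -> norm1 (M x y) <= K.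
Proof.
move=> [_ MK _]; rewrite -lee_fin; apply: le_trans (MK x).
exact: (esum_ge_term (fun y => (norm1 (M x y))%:E)).
Qed.

(** For row x of the product the weights are row x of M and the kernel is N; for column z the
    weights are column z of N and the kernel is the transpose of M. *)
Lemma schur_bounded_mul M N K L :
  schur_bounded M K -> schur_bounded N L -> schur_bounded (mxmult M N) (K * L).
Proof.
move=> [K0 Mr Mc] [L0 Nr Nc]; split=> [|x|z]; first by rewrite mulr_ge0.
- rewrite mulrC; apply: le_trans (esum_kernel_le _ _ L0 (Mr x) Nr).
  + apply: le_esum => z _; apply: le_trans (le_norm1_csum _) _.
    by apply: le_esum => y _; rewrite lee_fin norm1M.
  + by move=> *; exact: norm1_ge0.
  + by move=> *; exact: norm1_ge0.
- apply: le_trans (esum_kernel_le (B := fun y x => norm1 (M x y)) _ _ K0 (Nc z) Mc).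
  + apply: le_esum => x _; apply: le_trans (le_norm1_csum _) _.
    by apply: le_esum => y _; rewrite lee_fin mulrC norm1M.
  + by move=> *; exact: norm1_ge0.
  + by move=> *; exact: norm1_ge0.
Qed.

Lemma schur_boundedZ c M K :
  schur_bounded M K -> schur_bounded (fun x y => c * M x y) (norm1 c * K).
Proof.
have h (g : V -> R[i]) : (\esum_(x in [set: V]) (norm1 (g x))%:E <= K%:E)%E ->
    (\esum_(x in [set: V]) (norm1 (c * g x))%:E <= (norm1 c * K)%:E)%E.
  move=> gK; apply: (@le_trans _ _
    (\esum_(x in [set: V]) ((norm1 c)%:E * (norm1 (g x))%:E))%E).
    by apply: le_esum => x _; rewrite -EFinM lee_fin norm1M.
  rewrite esumZl ?norm1_ge0// => [|x]; last by rewrite lee_fin norm1_ge0.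
  by rewrite EFinM lee_wpmul2l ?lee_fin ?norm1_ge0.
by move=> [K0 Mr Mc]; split=> [|x|y]; [rewrite mulr_ge0 ?norm1_ge0|exact: h|exact: h].
Qed.

Lemma schur_bounded_id : schur_bounded (Defs.mxdiag (fun=> 1)) 1.
Proof.
have h x y : norm1 ((1 *+ (x == y))%:C : R[i]) = (x == y)%:R.
  by rewrite norm1_real normr_nat.
split=> [//|x|y].
- rewrite (@esum_single _ _ _ x) ?lee_fin ?norm1_ge0 ?h ?eqxx// => y yx.
  by rewrite h eq_sym (negbTE yx).
- rewrite (@esum_single _ _ _ y) ?lee_fin ?norm1_ge0 ?h ?eqxx// => x xy.
  by rewrite h (negbTE xy).
Qed.

Lemma schur_bounded_pow M K k :
  schur_bounded M K -> schur_bounded (mxpow M k) (K ^+ k).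
Proof.
move=> MK; elim: k => [|k IH]; first exact: schur_bounded_id.
by rewrite exprS; exact: schur_bounded_mul.
Qed.

(** The discriminant argument, evaluated at the minimizer [l = S / K]. It yields Cauchy-Schwarz for
    infinite sums from inequalities that can be summed term by term. *)
Lemma sqr_le_of_quadratic (S K T : R) : 0 <= S -> 0 <= K -> 0 <= T ->
  (forall l, 0 <= l -> 2 * l * S <= l ^+ 2 * K + T) -> S ^+ 2 <= K * T.
Proof.
move=> S0 K0 T0; have [->|Kn0] := eqVneq K 0 => H.
  have [->|Sn0] := eqVneq S 0; first by rewrite expr0n mul0r.
  have Sp : 0 < S by rewrite lt_neqAle eq_sym Sn0.
  (* For K = 0 this l makes the left side [2 (T + 1)], which exceeds T. *)
  have := H ((T + 1) / S) (divr_ge0 (addr_ge0 T0 ler01) S0).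
  rewrite -mulrA divfK// mulr0 => h.
  by exfalso; lra.
have Kp : 0 < K by rewrite lt_neqAle eq_sym Kn0.
have := H (S / K) (divr_ge0 S0 K0).
have -> : 2 * (S / K) * S = 2 * (S ^+ 2 / K) by field.
have -> : (S / K) ^+ 2 * K = S ^+ 2 / K by field.
by rewrite -ler_pdivrMl// mulrC => ?; lra.
Qed.

(** The row bound is the coefficient of [l ^+ 2] in the quadratic for each coordinate, giving
    [norm1 (mxact M u x) ^+ 2 <= K * T x]; the column bound then controls the sum of [T x] over
    x. *)
Lemma le_opnorm M K : schur_bounded M K -> (opnorm M <= (2 * K)%:E)%E.
Proof.
move=> [K0 Mr Mc]; apply: ge_ereal_sup => _ [u /= u1 <-].
have u2 : (\esum_(x in [set: V]) (norm1 (u x) ^+ 2)%:E <= 2%:E)%E.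
  have {}u1 : (\esum_(x in [set: V])
      (ComplexField.Normc.normc (u x) ^+ 2)%:E <= 1%:E)%E.
    have e1 : (1 = sqrte 1%:E :> \bar R)%E by rewrite /= sqrtr1.
    by move: u1; rewrite /l2norm [X in (_ <= X)%E -> _]e1 lee_sqrt ?lee_fin.
  apply: (@le_trans _ _ (\esum_(x in [set: V]) (2%:E *
      (ComplexField.Normc.normc (u x) ^+ 2)%:E))%E).
    by apply: le_esum => x _; rewrite -EFinM lee_fin; case: (norm1_normc (u x)).
  rewrite esumZl// => [|x]; last by rewrite lee_fin sqr_ge0.
  by rewrite -[leRHS]mule1 lee_wpmul2l ?lee_fin.
pose T x := (\esum_(y in [set: V]) (norm1 (u y) ^+ 2 * norm1 (M x y))%:E)%E.
have T0 x : (0 <= T x)%E.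
  by apply: esum_ge0 => y _; rewrite lee_fin mulr_ge0 ?sqr_ge0 ?norm1_ge0.
have TK : (\esum_(x in [set: V]) T x <= (K * 2)%:E)%E.
  apply: (esum_kernel_le (B := fun y x => norm1 (M x y))) => //.
  - by move=> x; rewrite sqr_ge0.
  - by move=> x y; exact: norm1_ge0.
have Tf x : T x \is a fin_num.
  rewrite ge0_fin_numE//; apply: (@le_lt_trans _ _ (K * 2)%:E); last exact: ltry.
  exact: le_trans (esum_ge_term T x) TK.
have ST x : norm1 (mxact M u x) ^+ 2 <= K * fine (T x).
  apply: sqr_le_of_quadratic => //.
  - exact: norm1_ge0.
  - exact: fine_ge0.
  move=> l l0; rewrite -lee_fin.
  have -> : ((l ^+ 2 * K + fine (T x))%:E = (l ^+ 2 * K)%:E + T x)%E.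
    by rewrite EFinD fineK.
  rewrite EFinM /T.
  apply: (@le_trans _ _ (\esum_(y in [set: V])
    ((l ^+ 2 * norm1 (M x y))%:E + (norm1 (u y) ^+ 2 * norm1 (M x y))%:E))%E).
    apply: (@le_trans _ _ ((2 * l)%:E *
        \esum_(y in [set: V]) (norm1 (M x y * u y))%:E)%E).
      by rewrite lee_wpmul2l ?le_norm1_csum// lee_fin mulr_ge0.
    rewrite -esumZl ?mulr_ge0// => [|y]; last by rewrite lee_fin norm1_ge0.
    apply: le_esum => y _; rewrite -EFinM -EFinD lee_fin.
    have := norm1M (M x y) (u y).
    have := norm1_ge0 (M x y); have := norm1_ge0 (u y).
    move: (norm1 (M x y * u y)) (norm1 (M x y)) (norm1 (u y)) =>
      c a b b0 a0 cab.
    apply: (@le_trans _ _ (2 * l * (a * b))); first by rewrite ler_wpM2l// mulr_ge0.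
    (* [2 l a b <= l^2 a + b^2 a]: optimizing over [l] gives Cauchy-Schwarz. *)
    by have := mulr_ge0 a0 (sqr_ge0 (l - b)); nra.
  rewrite esumD.
  - rewrite leeD2r//; under eq_esum do rewrite EFinM.
    rewrite esumZl ?sqr_ge0// => [|y]; last by rewrite lee_fin norm1_ge0.
    by rewrite (EFinM (l ^+ 2) K) lee_wpmul2l ?lee_fin ?sqr_ge0.
  - by move=> y _; rewrite lee_fin mulr_ge0 ?sqr_ge0 ?norm1_ge0.
  - by move=> y _; rewrite lee_fin mulr_ge0 ?sqr_ge0 ?norm1_ge0.
have Nle : (\esum_(x in [set: V])
    (ComplexField.Normc.normc (mxact M u x) ^+ 2)%:E <= ((2 * K) ^+ 2)%:E)%E.
  apply: (@le_trans _ _ (\esum_(x in [set: V]) (K%:E * T x))%E).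
    apply: le_esum => x _; rewrite -(fineK (Tf x)) -EFinM lee_fin.
    by apply: le_trans (ST x); case: (norm1_normc (mxact M u x)).
  rewrite esumZl//; apply: (@le_trans _ _ (K%:E * (K * 2)%:E)%E).
    by rewrite lee_wpmul2l ?lee_fin.
  (* The estimate obtained is [2 K^2]; relaxing it to [(2 K)^2] avoids a square root of 2 in the
     bound. *)
  by rewrite -EFinM lee_fin; nra.
have K20 : 0 <= 2 * K by rewrite mulr_ge0.
have -> : ((2 * K)%:E = sqrte ((2 * K) ^+ 2)%:E)%E.
  by rewrite /= sqrtr_sqr ger0_norm.
by rewrite /l2norm lee_sqrt ?lee_fin ?sqr_ge0.
Qed.

End SchurTest.

(** * Tails of the real exponential series *)

Section ExpTail.
Local Open Scope classical_set_scope.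
Variables (R : realType) (K : R) (K0 : 0 <= K).

(** Padded with zeros to an unordered sum over all of [nat], so that it can be exchanged with sums
    over vertices. *)
Definition exp_tail m : \bar R :=
  (\esum_(k in [set: nat]) (if (m <= k)%N then exp_coeff K k else 0)%:E)%E.

Lemma exp_tail_ge0 m : (0 <= exp_tail m)%E.
Proof.
by apply: esum_ge0 => k _; case: ifP => // _; rewrite lee_fin exp_coeff_ge0.
Qed.

Lemma exp_series_lty : (\sum_(0 <= k <oo) (exp_coeff K k)%:E < +oo)%E.
Proof.
have -> : (\sum_(0 <= k <oo) (exp_coeff K k)%:E = (expR K)%:E)%E; last exact: ltry.
rewrite /expR -EFin_lim; last exact: is_cvg_series_exp_coeff.
by apply: congr_lim; apply/funext => m; rewrite /= /series/= sumEFin.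
Qed.

Lemma exp_tailE m : exp_tail m = (\sum_(m <= k <oo) (exp_coeff K k)%:E)%E.
Proof.
rewrite eseries_cond/= eseries_mkcond nneseries_esumT => [|k]; last first.
  by case: ifP => // _; rewrite lee_fin exp_coeff_ge0.
by apply: eq_esum => k _; case: ifP.
Qed.

Lemma exp_tail_fin_num m : exp_tail m \is a fin_num.
Proof.
rewrite ge0_fin_numE ?exp_tail_ge0//; apply: le_lt_trans exp_series_lty.
rewrite nneseries_esumT => [|k]; last by rewrite lee_fin exp_coeff_ge0.
by apply: le_esum => k _; case: ifP => // _; rewrite lee_fin exp_coeff_ge0.
Qed.

Lemma cvg_exp_tail : fine (exp_tail m) @[m --> \oo] --> (0 : R).
Proof.
apply: fine_cvg; under eq_cvg do rewrite exp_tailE.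
by apply: nneseries_tail_cvg exp_series_lty _ => k _; rewrite lee_fin exp_coeff_ge0.
Qed.

End ExpTail.

(** * Existence of the exponential and convergence of its entries *)

Section Exponential.
Local Open Scope classical_set_scope.
Variables (R : realType) (V : countType).
Implicit Types (M : V -> V -> R[i]).

Definition exp_partial M m : V -> V -> R[i] :=
  fun x y => \sum_(k < m) (k`!%:R)^-1 * mxpow M k x y.

Definition exp_term M k : V -> V -> R[i] :=
  fun x y => (k`!%:R)^-1 * mxpow M k x y.

Lemma schur_bounded_exp_term M K k :
  schur_bounded M K -> schur_bounded (exp_term M k) (exp_coeff K k).
Proof.
move=> MK; have := schur_boundedZ (k`!%:R)^-1 (schur_bounded_pow k MK).
have -> : (k`!%:R)^-1 = ((k`!%:R)^-1)%:C :> R[i] by rewrite fmorphV rmorph_nat.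
rewrite norm1_real ger0_norm ?invr_ge0// mulrC /exp_coeff/= /exp_term.
by rewrite fmorphV rmorph_nat.
Qed.

(** The candidate exponential; taking each entry as a [csum] over [nat] makes the lemmas on
    countable families apply to it. *)
Definition exp_series M : V -> V -> R[i] :=
  fun x y => csum (fun k : nat => exp_term M k x y).

Definition exp_rest M m : V -> V -> R[i] :=
  fun x y => csum (fun k : nat => if (m <= k)%N then exp_term M k x y else 0).

Lemma exp_partialB M K m x y : schur_bounded M K ->
  exp_partial M m x y - exp_series M x y = - exp_rest M m x y.
Proof.
move=> MK; have K0 : 0 <= K by case: MK.
(* [h j] is the series reduced to its term j. It turns the finite partial sum into a countable sum,
   to which the rest can be added by [csumD]. *)
pose h j k : R[i] := if k == j then exp_term M j x y else 0.
have hj j k : k != j -> h j k = 0 by rewrite /h => /negbTE ->.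
have [hs hE] := @csum_sum R _ _ (index_iota 0 m) h
  (fun j => abs_summable_single (hj j)).
have ts : abs_summable (fun k => if (m <= k)%N then exp_term M k x y else 0).
  apply: (@abs_summable_le _ _ _ (fun k => if (m <= k)%N then exp_coeff K k else 0)).
    move=> k; case: ifP => _; last by rewrite norm10.
    exact: (schur_bounded_entry _ _ (schur_bounded_exp_term k MK)).
  by rewrite -ge0_fin_numE ?exp_tail_ge0// exp_tail_fin_num.
have -> : exp_series M x y = exp_partial M m x y + exp_rest M m x y.
  have -> : exp_partial M m x y = csum (fun k => \sum_(j <- index_iota 0 m) h j k).
    rewrite hE /exp_partial -(big_mkord xpredT (fun k => exp_term M k x y)).
    apply: eq_bigr => j _; rewrite (csum_single (hj j)).
    by rewrite /h eqxx.
  rewrite -csumD//; congr csum; apply/funext => k.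
  case: leqP => mk.
    rewrite big1_seq ?add0r// => j /andP[_]; rewrite mem_index_iota => /andP[_ jm].
    by rewrite hj// gtn_eqF// (leq_trans jm).
  rewrite addr0 (bigD1_seq k) ?mem_index_iota ?iota_uniq//= /h eqxx big1 ?addr0//.
  by move=> j jk; rewrite eq_sym (negbTE jk).
by rewrite opprD addrA subrr add0r.
Qed.

(** Exchanging the sum over vertices with the sum over k leaves the Schur bound of each term, that
    is, the tail of the real series. Rows and columns are the same argument, isolated in [h]. *)
Lemma schur_bounded_exp_rest M K m : schur_bounded M K ->
  schur_bounded (exp_rest M m) (fine (exp_tail K m)).
Proof.
move=> MK; have K0 : 0 <= K by case: MK.
have h (g : nat -> V -> R[i]) :
    (forall k, \esum_(x in [set: V]) (norm1 (g k x))%:E <= (exp_coeff K k)%:E)%E ->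
    (\esum_(x in [set: V]) (norm1 (csum (fun k => if (m <= k)%N then g k x else 0)))%:E
      <= (fine (exp_tail K m))%:E)%E.
  move=> gK; rewrite (fineK (exp_tail_fin_num K0 m)).
  apply: (@le_trans _ _ (\esum_(x in [set: V]) \esum_(k in [set: nat])
      (norm1 (if (m <= k)%N then g k x else 0))%:E)%E).
    by apply: le_esum => x _; exact: le_norm1_csum.
  rewrite esum_exchange => [|x k]; last by rewrite lee_fin norm1_ge0.
  apply: le_esum => k _; case: ifP => _ //.
  by rewrite esum1// => x _; rewrite norm10.
split=> [|x|y].
- exact/fine_ge0/exp_tail_ge0.
- by apply: (h (fun k y => exp_term M k x y)) => k; case: (schur_bounded_exp_term k MK).
- by apply: (h (fun k x => exp_term M k x y)) => k; case: (schur_bounded_exp_term k MK).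
Qed.

Lemma opnorm_ge0 M : (0 <= opnorm M)%E.
Proof.
apply: le_ereal_sup_tmp; exists (l2norm (mxact M (fun=> 0))) => /=; last exact: sqrte_ge0.
exists (fun=> 0) => //=; rewrite /l2norm esum1 /= ?sqrtr0// => x _.
by rewrite /= ?expr0n/= ?addr0 ?sqrtr0 ?expr0n.
Qed.

Lemma l2norm_ket (a : V) : l2norm (ket R a) = 1%E.
Proof.
rewrite /l2norm (@esum_single _ _ _ a) ?lee_fin ?sqr_ge0//.
  by rewrite /ket eqxx ComplexField.Normc.normc1 expr1n /= sqrtr1.
by move=> y ya; rewrite /ket (negbTE ya) ComplexField.Normc.normc0 expr0n.
Qed.

Lemma mxact_ket M a x : mxact M (ket R a) x = M x a.
Proof.
rewrite /mxact (csum_single (x := a)) /ket ?eqxx ?mulr1// => y ya.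
by rewrite (negbTE ya) mulr0.
Qed.

Lemma normc_le_l2norm (u : V -> R[i]) x :
  ((ComplexField.Normc.normc (u x))%:E <= l2norm u)%E.
Proof.
have n0 : 0 <= ComplexField.Normc.normc (u x) by case: (u x) => a b; exact: sqrtr_ge0.
have -> : ((ComplexField.Normc.normc (u x))%:E =
    sqrte (ComplexField.Normc.normc (u x) ^+ 2)%:E)%E.
  by rewrite /= sqrtr_sqr ger0_norm.
rewrite lee_sqrt ?(esum_ge_term (fun x => (ComplexField.Normc.normc (u x) ^+ 2)%:E))//.
by apply: esum_ge0 => y _; rewrite lee_fin sqr_ge0.
Qed.

(** The entry is coordinate x of the image of the unit vector [ket R y], hence at most the operator
    norm in modulus; the factor 2 stands for the square root of 2. *)
Lemma norm1_le_opnorm M x y : ((norm1 (M x y))%:E <= 2%:E * opnorm M)%E.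
Proof.
have h : ((ComplexField.Normc.normc (M x y))%:E <= opnorm M)%E.
  rewrite -(mxact_ket M y x); apply: le_trans (normc_le_l2norm _ _) _.
  by apply: ereal_sup_ubound; exists (ket R y) => //=; rewrite l2norm_ket.
apply: le_trans (lee_wpmul2l _ h); last by rewrite lee_fin.
rewrite -EFinM lee_fin; have [_] := norm1_normc (M x y).
have : 0 <= ComplexField.Normc.normc (M x y).
  by case: (M x y) => a b; exact: sqrtr_ge0.
have := norm1_ge0 (M x y); move: (norm1 _) (ComplexField.Normc.normc _) => p q.
by nra.
Qed.

(** Existence of some exponential is enough for [xget]. For [exp_series] the error at stage m is
    [- exp_rest M m], whose norm is at most twice a tail of the real series. *)
Lemma expmxP M K : schur_bounded M K -> is_expmx M (expmx M).
Proof.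
move=> MK; rewrite /expmx; apply: (@xgetPex _ _ [set E | is_expmx M E]).
exists (exp_series M); rewrite /= /is_expmx.
have K0 : 0 <= K by case: MK.
apply: (@squeeze_cvge _ _ _ _ (fun=> 0%E) _
    (fun m => (2 * fine (exp_tail K m))%:E)).
- apply: nearW => m; rewrite opnorm_ge0/=.
  apply: le_opnorm.
  have := schur_boundedZ (-1) (schur_bounded_exp_rest m MK).
  rewrite norm1N norm1_real normr1 mul1r.
  have -> : (fun x y => -1 * exp_rest M m x y) =
    (fun x y => \sum_(k < m) (k`!%:R)^-1 * mxpow M k x y - exp_series M x y).
    by apply/funext => x; apply/funext => y; rewrite mulN1r -(exp_partialB _ _ _ MK).
  by [].
- exact: cvg_cst.
- apply: cvg_EFin; first exact: nearW.
  rewrite -[X in _ --> X](mulr0 2); apply: cvgMl_tmp; exact: cvg_exp_tail.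
Qed.

(** All that is used of [expmx] afterwards. *)
Lemma cvg_exp_partial M K x y : schur_bounded M K ->
  norm1 (exp_partial M m x y - expmx M x y) @[m --> \oo] --> (0 : R).
Proof.
move=> /expmxP MK; apply: (@fine_cvg _ _ _ _
  (fun m => (norm1 (exp_partial M m x y - expmx M x y))%:E)).
pose E m := opnorm (fun x y => exp_partial M m x y - expmx M x y).
apply: (@squeeze_cvge _ _ _ _ (fun=> 0%E) _ (fun m => 2%:E * E m)%E).
- apply: nearW => m; rewrite lee_fin norm1_ge0/=.
  exact: (norm1_le_opnorm (fun x y => exp_partial M m x y - expmx M x y)).
- exact: cvg_cst.
- by rewrite -[X in _ --> X](mule0 2%:E); apply: cvgeZl.
Qed.

End Exponential.

(** * The exponential on finitely supported vectors *)

Section PowerIterates.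
Local Open Scope classical_set_scope.
Variables (R : realType) (V : countType).
Implicit Types (M : V -> V -> R[i]) (u v : V -> R[i]).

Definition bounded_fun u : Prop := exists B : R, forall x, norm1 (u x) <= B.

Lemma abs_summable_bounded u : abs_summable u -> bounded_fun u.
Proof.
rewrite /abs_summable => us; exists (fine (\esum_(x in [set: V]) (norm1 (u x))%:E)).
move=> x; rewrite -lee_fin fineK.
  exact: (esum_ge_term (fun x => (norm1 (u x))%:E)).
by rewrite ge0_fin_numE//; apply: esum_ge0 => y _; rewrite lee_fin norm1_ge0.
Qed.

Lemma bounded_fun_scale u (d : V -> R[i]) :
  bounded_fun d -> bounded_fun u -> bounded_fun (fun x => d x * u x).
Proof.
move=> [C dC] [B uB]; exists (C * B) => x; apply: le_trans (norm1M _ _) _.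
by apply: ler_pM => //; exact: norm1_ge0.
Qed.

Lemma abs_summable_mxact M K u x : schur_bounded M K -> bounded_fun u ->
  abs_summable (fun y => M x y * u y).
Proof.
move=> [K0 MK _] [B uB].
have B0 : 0 <= B := le_trans (norm1_ge0 _) (uB x).
apply: (@abs_summable_le _ _ _ (fun y => B * norm1 (M x y))).
  move=> y; rewrite mulrC; apply: le_trans (norm1M _ _) _.
  by rewrite ler_wpM2r ?norm1_ge0.
under eq_esum do rewrite EFinM.
rewrite esumZl// => [|y]; last by rewrite lee_fin norm1_ge0.
rewrite lte_mul_pinfty ?lee_fin//.
exact: le_lt_trans (MK x) (ltry _).
Qed.

Lemma mxact_bounded M K u : schur_bounded M K -> bounded_fun u ->
  bounded_fun (mxact M u).
Proof.
move=> MK [B uB]; exists (B * K) => x.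
have B0 : 0 <= B := le_trans (norm1_ge0 _) (uB x).
rewrite -lee_fin; apply: le_trans (le_norm1_csum _) _.
apply: (@le_trans _ _ (\esum_(y in [set: V]) (B%:E * (norm1 (M x y))%:E))%E).
  apply: le_esum => y _; rewrite -EFinM lee_fin mulrC.
  by apply: le_trans (norm1M _ _) _; rewrite ler_wpM2r ?norm1_ge0.
rewrite esumZl// => [|y]; last by rewrite lee_fin norm1_ge0.
by rewrite EFinM lee_wpmul2l ?lee_fin//; case: MK.
Qed.

Lemma iter_mxact_bounded M K u k : schur_bounded M K -> bounded_fun u ->
  bounded_fun (iter k (mxact M) u).
Proof.
by move=> MK ub; elim: k => //= k; exact: (mxact_bounded MK).
Qed.

(** [mxpow] multiplies by M on the left, so each of its columns satisfies the recursion of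
    [iter k (mxact M)]. *)
Lemma mxpow_ket M k x a : mxpow M k x a = iter k (mxact M) (ket R a) x.
Proof.
elim: k x => [|k IH] x; first by rewrite /mxpow /= /Defs.mxdiag /ket; case: eqP.
rewrite /mxpow /= -/(mxpow M k) /mxmult /mxact.
by congr csum; apply/funext => y; rewrite IH.
Qed.

Lemma scale_funE c u x : (c *: u) x = c * u x.
Proof. by []. Qed.

Definition fin_supp u : Prop := exists s : seq V, forall x, x \notin s -> u x = 0.

Lemma fin_suppZ c u : fin_supp u -> fin_supp (c *: u).
Proof. by move=> [s us]; exists s => x xs; rewrite scale_funE us ?mulr0. Qed.

Lemma fin_suppM (d : V -> R[i]) u : fin_supp u -> fin_supp (fun x => d x * u x).
Proof. by move=> [s us]; exists s => x /us ->; rewrite mulr0. Qed.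

Lemma fin_supp_sumE u : fin_supp u ->
  exists s : seq V, forall x, u x = \sum_(p <- s) u p * ket R p x.
Proof.
(* A vertex repeated in [s] would otherwise be counted several times. *)
move=> [s us]; exists (undup s) => x.
have [xs|xs] := boolP (x \in undup s).
  rewrite (bigD1_seq x)//= ?undup_uniq// /ket eqxx mulr1 big1 ?addr0// => p px.
  by rewrite eq_sym (negbTE px) mulr0.
rewrite us -?(mem_undup s)// big1_seq// => p /= ps.
by rewrite /ket; case: eqVneq => [xp|_]; rewrite ?mulr0//; rewrite xp ps in xs.
Qed.

Lemma fin_supp_csum (c : V -> R[i]) u (s : seq V) :
  (forall x, u x = \sum_(p <- s) u p * ket R p x) ->
  abs_summable (fun y => c y * u y) /\
  csum (fun y => c y * u y) = \sum_(p <- s) u p * c p.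
Proof.
move=> us.
have hs p : abs_summable (fun y => u p * (c y * ket R p y)).
  apply: (@abs_summable_single _ _ _ p) => y yp.
  by rewrite /ket (negbTE yp) !mulr0.
have -> : (fun y => c y * u y) = (fun y => \sum_(p <- s) u p * (c y * ket R p y)).
  apply/funext => y; rewrite {1}us mulr_sumr; apply: eq_bigr => p _.
  by rewrite mulrCA.
have [? ->] := csum_sum s hs; split => //; apply: eq_bigr => p _.
rewrite (csum_single (x := p)) /ket ?eqxx ?mulr1// => y yp.
by rewrite (negbTE yp) !mulr0.
Qed.

Lemma fin_supp_abs_summable u : fin_supp u -> abs_summable u.
Proof.
move=> /fin_supp_sumE[s us]; have [+ _] := fin_supp_csum (fun=> 1) us.
by under eq_fun do rewrite mul1r.
Qed.

Lemma abs_summable_mxact_fin_supp M u x :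
  fin_supp u -> abs_summable (fun y => M x y * u y).
Proof. by move=> /fin_supp_sumE[s us]; case: (fin_supp_csum (M x) us). Qed.

Lemma mxact_fin_suppZ M c u x : fin_supp u -> mxact M (c *: u) x = c * mxact M u x.
Proof.
move=> uf; rewrite /mxact -csumZ; last exact: abs_summable_mxact_fin_supp.
by congr csum; apply/funext => y; rewrite scale_funE mulrCA.
Qed.

(** Only a finite sum is moved through [csum]; the summability this requires comes from boundedness
    of the iterates of [ket R p]. *)
Lemma iter_mxact_fin_supp M K u (s : seq V) k x : schur_bounded M K ->
  (forall x, u x = \sum_(p <- s) u p * ket R p x) ->
  iter k (mxact M) u x = \sum_(p <- s) u p * mxpow M k x p.
Proof.
move=> MK us; elim: k x => [|k IH] x.
  by rewrite [LHS]us; apply: eq_bigr => p _; rewrite mxpow_ket.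
have ketb p : bounded_fun (ket R p).
  apply: abs_summable_bounded; apply: (@abs_summable_single _ _ _ p) => y yp.
  by rewrite /ket (negbTE yp).
have hs p : abs_summable (fun y => M x y * mxpow M k y p).
  have := abs_summable_mxact x MK (iter_mxact_bounded k MK (ketb p)).
  by congr abs_summable; apply/funext => y; rewrite mxpow_ket.
have [_ e] := csum_sum s (fun p => abs_summableZ (u p) (hs p)).
rewrite iterS /mxact.
transitivity (csum (fun y => \sum_(p <- s) u p * (M x y * mxpow M k y p))).
  congr csum; apply/funext => y; rewrite IH mulr_sumr.
  by apply: eq_bigr => p _; rewrite mulrCA.
rewrite e; apply: eq_bigr => p _.
by rewrite csumZ.
Qed.

Lemma cvg_sum0 (I : Type) (r : seq I) (F : I -> nat -> R) :
  (forall i, F i m @[m --> \oo] --> (0 : R)) ->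
  \sum_(i <- r) F i m @[m --> \oo] --> (0 : R).
Proof.
move=> F0; elim: r => [|i r IH].
  have -> : (fun m => \sum_(i <- [::]) F i m) = fun=> 0.
    by apply/funext => m; rewrite big_nil.
  exact: cvg_cst.
have -> : (fun m => \sum_(j <- i :: r) F j m) = fun m => F i m + \sum_(j <- r) F j m.
  by apply/funext => m; rewrite big_cons.
by rewrite -[X in _ --> X]addr0; exact: cvgD.
Qed.

Lemma cvg_exp_iter M K u x : schur_bounded M K -> fin_supp u ->
  norm1 (\sum_(k < m) (k`!%:R)^-1 * iter k (mxact M) u x - mxact (expmx M) u x)
    @[m --> \oo] --> (0 : R).
Proof.
move=> MK /fin_supp_sumE[s us].
have e : mxact (expmx M) u x = \sum_(p <- s) u p * expmx M x p.
  by case: (fin_supp_csum (expmx M x) us).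
apply: (@squeeze_cvgr _ _ _ _ (fun=> 0) (fun m => \sum_(p <- s)
  norm1 (u p) * norm1 (exp_partial M m x p - expmx M x p))).
- apply: nearW => m; rewrite norm1_ge0 /= e.
  have -> : \sum_(k < m) (k`!%:R)^-1 * iter k (mxact M) u x =
      \sum_(p <- s) u p * exp_partial M m x p.
    under [RHS]eq_bigr do rewrite mulr_sumr.
    rewrite exchange_big /=; apply: eq_bigr => k _.
    rewrite (iter_mxact_fin_supp k x MK us) mulr_sumr.
    by apply: eq_bigr => p _; rewrite mulrCA.
  rewrite -sumrB; elim: (s) => [|p r IH]; first by rewrite !big_nil norm10.
  rewrite !big_cons; apply: le_trans (norm1D _ _) _; apply: lerD => //.
  by rewrite -mulrBr norm1M.
- exact: cvg_cst.
- apply: cvg_sum0 => p.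
  rewrite -[X in _ --> X](mulr0 (norm1 (u p))); apply: cvgMl_tmp.
  exact: cvg_exp_partial MK.
Qed.

End PowerIterates.

(** * Comparison of two exponentials through their powers *)

Section Transfer.
Local Open Scope classical_set_scope.
Variable R : realType.

(** The partial sums on the two sides agree up to c at every stage, so the constant [norm1 D] is
    squeezed to 0. The form is pointwise, so that the vertex sets may differ (blow-ups) and c may
    depend on the vertex (c = [d x] for a switching). *)
Lemma expmx_transfer (V W : countType) (M : V -> V -> R[i]) (N : W -> W -> R[i])
    K L c u v x y :
  schur_bounded M K -> schur_bounded N L -> fin_supp u -> fin_supp v ->
  (forall k, iter k (mxact M) u x = c * iter k (mxact N) v y) ->
  mxact (expmx M) u x = c * mxact (expmx N) v y.
Proof.
move=> MK NL uf vf H; apply/subr0_eq/norm1_eq0.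
set D := _ - _.
have : cst (norm1 D) @ \oo --> (0 : R); last first.
  by move=> D0; have := cvg_unique _ D0 (cvg_cst (norm1 D)); move=> /(_ _) ->.
apply: (@squeeze_cvgr _ _ _ _ (fun=> 0) (fun m =>
  norm1 (\sum_(k < m) (k`!%:R)^-1 * iter k (mxact M) u x - mxact (expmx M) u x) +
  norm1 c * norm1 (\sum_(k < m) (k`!%:R)^-1 * iter k (mxact N) v y -
    mxact (expmx N) v y))).
- apply: nearW => m; rewrite norm1_ge0 /= -norm1N.
  apply: le_trans (lerD (lexx _) (norm1M _ _)).
  rewrite -[X in _ <= _ + X]norm1N.
  have -> : - D = (\sum_(k < m) (k`!%:R)^-1 * iter k (mxact M) u x - mxact (expmx M) u x)
      - c * (\sum_(k < m) (k`!%:R)^-1 * iter k (mxact N) v y - mxact (expmx N) v y).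
    have -> : \sum_(k < m) (k`!%:R)^-1 * iter k (mxact M) u x =
        c * \sum_(k < m) (k`!%:R)^-1 * iter k (mxact N) v y.
      by rewrite mulr_sumr; apply: eq_bigr => k _; rewrite H mulrCA.
    by rewrite /D; ring.
  exact: norm1D.
- exact: cvg_cst.
- rewrite -[X in _ --> X]addr0; apply: cvgD; first exact: cvg_exp_iter MK uf.
  rewrite -[X in _ --> X](mulr0 (norm1 c)); apply: cvgMl_tmp.
  exact: cvg_exp_iter NL vf.
Qed.

End Transfer.

(** * Blow-ups and signed graphs *)

Section WalkMatrices.
Local Open Scope classical_set_scope.
Variables (R : realType) (V : countType).
Implicit Types (G : wgraph R V) (d : V -> R) (u v : V -> R[i]).

Definition degree_le G (K : R) : Prop :=
  0 <= K /\ forall x, (\esum_(y in [set: V]) `|weight G x y|%:E <= K%:E)%E.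

Lemma bounded_graph_degree_le G : bounded_graph G -> exists K, degree_le G K.
Proof.
move=> [_ [K GK]]; exists `|K|; split => // x.
by apply: le_trans (GK x) _; rewrite lee_fin ler_norm.
Qed.

Definition generator G (t : R) : V -> V -> R[i] :=
  fun x y => (0 +i* t) * adjmx G x y.

(** Symmetry of the weights turns the bound on row sums into one on column sums. *)
Lemma schur_bounded_generator G K t :
  degree_le G K -> schur_bounded (generator G t) (norm1 (0 +i* t) * K).
Proof.
move=> [K0 GK]; apply: schur_boundedZ; split => // x.
- by under eq_esum do rewrite norm1_real; exact: GK.
- by under eq_esum do rewrite norm1_real (weight_sym G _ x); exact: GK.
Qed.

Lemma degree_le_signed d G K : signing d -> degree_le G K -> degree_le (signed d G) K.
Proof.
move=> ds [K0 GK]; split => // x; under eq_esum => y _.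
  have nd z : `|d z| = 1 by case: (ds z) => ->; rewrite ?normrN normr1.
  by rewrite /= !normrM !nd mul1r mulr1; over.
exact: GK.
Qed.

Lemma fin_supp_ket (a : V) : fin_supp (ket R a).
Proof. by exists [:: a] => x; rewrite inE /ket => /negbTE ->. Qed.

(** The normalizing factors are nonzero and can be absorbed into g: the points x and y make the
    norms positive, and finite support makes them finite, whereas [fine] would send an infinite norm
    to 0. *)
Lemma pst_iff G t K u v x y :
  degree_le G K -> fin_supp u -> fin_supp v -> u x != 0 -> v y != 0 ->
  pst G t u v <-> exists g, forall z, mxact (transition G t) u z = g * v z.
Proof.
move=> GK uf vf ux vy.
have norm_neq0 (w : V -> R[i]) z : fin_supp w -> w z != 0 ->
    ((fine (l2norm w))^-1%:C : R[i]) != 0.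
  move=> wf wz; rewrite (fmorph_eq0 (real_complex R)) invr_eq0.
  have [B wB] := abs_summable_bounded (fin_supp_abs_summable wf).
  have B0 : 0 <= B := le_trans (norm1_ge0 _) (wB z).
  rewrite gt_eqF// fine_gt0//; apply/andP; split.
    apply: (@lt_le_trans _ _ (ComplexField.Normc.normc (w z))%:E); last first.
      exact: normc_le_l2norm.
    rewrite lte_fin lt_neqAle; apply/andP; split; last first.
      by case: (w z) => a b; exact: sqrtr_ge0.
    by apply: contra wz => /eqP/esym/ComplexField.Normc.eq0_normc ->.
  rewrite -ge0_fin_numE ?sqrte_ge0// sqrte_fin_num; last first.
    by apply: esum_ge0 => *; rewrite lee_fin sqr_ge0.
  rewrite ge0_fin_numE; last by apply: esum_ge0 => *; rewrite lee_fin sqr_ge0.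
  apply: (@le_lt_trans _ _ (\esum_(x in [set: V]) (B%:E * (norm1 (w x))%:E))%E).
    apply: le_esum => q _; rewrite -EFinM lee_fin.
    have [+ _] := norm1_normc (w q) => /le_trans; apply.
    by rewrite expr2 ler_wpM2r ?norm1_ge0.
  rewrite esumZl// => [|q]; last by rewrite lee_fin norm1_ge0.
  by rewrite lte_mul_pinfty ?lee_fin//; exact: fin_supp_abs_summable.
have := norm_neq0 u x uf ux; have := norm_neq0 v y vf vy.
rewrite /pst /normalize.
move: ((fine (l2norm u))^-1%:C) ((fine (l2norm v))^-1%:C) =>
  cu cv cv0 cu0; split => -[g H].
- exists (cu^-1 * g * cv) => z; have := congr1 (fun f => f z) H.
  rewrite mxact_fin_suppZ// !scale_funE => e.
  by rewrite -!mulrA -e mulKf.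
- exists (cu * g * cv^-1); apply/funext => z.
  by rewrite mxact_fin_suppZ// !scale_funE H -!mulrA mulKf.
Qed.

End WalkMatrices.

(** * Walks on blow-ups *)

Section Blowup.
Local Open Scope classical_set_scope.
Variables (R : realType) (V : countType) (n : nat).
Implicit Types (G : wgraph R V) (u : V -> R[i]).

Lemma degree_le_blowup G K : degree_le G K -> degree_le (blowup n G) (n%:R * K).
Proof.
move=> [K0 GK]; split => [|[i x]]; first by rewrite mulr_ge0.
under eq_esum do rewrite /= mxE mul1r.
rewrite (esum_snd n (f := fun y => `|weight G x y|%:E))//.
by rewrite EFinM lee_wpmul2l ?lee_fin.
Qed.

(** The tensor product of the all-ones vector with [ket R a], written as a function of [p.2] to
    match [iter_generator_blowup]. *)
Definition lift_ket (a : V) : 'I_n * V -> R[i] := fun p => ket R a p.2.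

Lemma lift_ketE a : lift_ket a = \sum_(j < n) ket R (j, a).
Proof.
apply/funext => -[i x]; rewrite fct_sumE (bigD1 i)//= big1 ?addr0.
  by rewrite /lift_ket /ket /= xpair_eqE eqxx.
by move=> j ji; rewrite /ket xpair_eqE eq_sym (negbTE ji).
Qed.

Lemma fin_supp_lift_ket a : fin_supp (lift_ket a).
Proof.
exists [seq (j, a) | j <- enum 'I_n] => -[i x] ix.
rewrite /lift_ket /ket /=; case: eqVneq => // xa; exfalso.
move/negP: ix; apply; apply/mapP; exists i; last by rewrite xa.
  by have := mem_enum (mem (ordinal n)) i => ->.
Qed.

(** Each application produces one factor n from the copies and one factor 1/n from the time, so the
    iterates agree exactly for every k. *)
Lemma iter_generator_blowup G K t u k p : (0 < n)%N -> degree_le G K ->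
  bounded_fun u ->
  iter k (mxact (generator (blowup n G) (t / n%:R))) (fun p => u p.2) p =
  iter k (mxact (generator G t)) u p.2.
Proof.
move=> n0 GK ub; elim: k p => //= k IH [i x] /=.
have SG := schur_bounded_generator t GK.
have fs := abs_summable_mxact x SG (iter_mxact_bounded k SG ub).
have [_ e] := csum_snd n (abs_summableZ n%:R^-1 fs).
have n0' : (n%:R : R[i]) != 0 by rewrite pnatr_eq0 -lt0n.
rewrite {1}/mxact; transitivity (csum (fun q : 'I_n * V => n%:R^-1 *
    (generator G t x q.2 * iter k (mxact (generator G t)) u q.2))).
  congr csum; apply/funext => q; rewrite IH mulrA; congr (_ * _).
  rewrite /generator /adjmx /= mxE mul1r mulrA; congr (_ * _).
  have -> : (n%:R^-1 : R[i]) = (n%:R^-1)%:C by rewrite fmorphV rmorph_nat.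
  by apply/eqP; rewrite eq_complex /= !(mul0r, mulr0, subr0, addr0) mulrC !eqxx.
by rewrite e csumZ// mulrA divff// mul1r.
Qed.

(** The scalars let one statement serve the plain sums over copies, the vectors scaled by
    [(Num.sqrt 2)^-1], and those that carry a sign. *)
Lemma pst_blowup G K t a b (s1 s2 : R[i]) : (0 < n)%N -> degree_le G K ->
  s1 != 0 -> s2 != 0 ->
  pst (blowup n G) (t / n%:R) (s1 *: lift_ket a) (s2 *: lift_ket b) <->
  pst G t (ket R a) (ket R b).
Proof.
move=> n0 GK s10 s20.
(* Copy 0 gives a point where the lifted vectors do not vanish, and restricting to it recovers the
   equation in H. *)
pose i0 := Ordinal n0.
have ket1 (c : V) : ket R c c != 0 by rewrite /ket eqxx oner_neq0.
have lket c (s : R[i]) : s != 0 -> (s *: lift_ket c) (i0, c) != 0.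
  by move=> s0; rewrite scale_funE mulf_eq0 negb_or s0; exact: ket1.
have fl c := fin_supp_lift_ket c.
rewrite (pst_iff t GK (fin_supp_ket R a) (fin_supp_ket R b) (ket1 a) (ket1 b)).
rewrite (pst_iff _ (degree_le_blowup GK) (fin_suppZ s1 (fl a)) (fin_suppZ s2 (fl b))
  (lket a s1 s10) (lket b s2 s20)).
have E p : mxact (transition (blowup n G) (t / n%:R)) (s1 *: lift_ket a) p =
    s1 * mxact (transition G t) (ket R a) p.2.
  rewrite mxact_fin_suppZ//; congr (_ * _).
  rewrite -[RHS]mul1r.
  apply: (expmx_transfer (schur_bounded_generator (t / n%:R) (degree_le_blowup GK))
    (schur_bounded_generator t GK) (fl a) (fin_supp_ket R a)) => k.
  rewrite mul1r; apply: (iter_generator_blowup t k p n0 GK).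
  exact/abs_summable_bounded/fin_supp_abs_summable/fin_supp_ket.
split => -[g H].
- exists (s1^-1 * (g * s2)) => x; have := H (i0, x); rewrite E scale_funE /= => e.
  by rewrite -!mulrA -e mulKf.
- exists (s1 * g * s2^-1) => p; rewrite E H scale_funE -!mulrA mulKf//.
Qed.

End Blowup.

Arguments lift_ket R {V} n a _.

(** * Switching by a diagonal sign matrix *)

Section Signed.
Variables (R : realType) (V : countType).
Implicit Types (G : wgraph R V) (d : V -> R) (u v : V -> R[i]).

Definition sign_fun d u : V -> R[i] := fun x => (d x)%:C * u x.

Lemma signing_sqr d x : signing d -> (d x)%:C * (d x)%:C = 1 :> R[i].
Proof.
by move=> ds; case: (ds x) => ->; rewrite -rmorphM/= ?mulrNN mul1r.
Qed.

Lemma signing_neq0 d x : signing d -> ((d x)%:C : R[i]) != 0.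
Proof.
move=> /(signing_sqr x) e; apply: contra_eq_neq e => ->.
by rewrite mul0r eq_sym oner_neq0.
Qed.

Lemma signing_mulE d (g A B : R[i]) x : signing d ->
  (d x)%:C * A = g * B <-> A = g * ((d x)%:C * B).
Proof.
move=> ds; rewrite (mulrCA g); split => [<-|->];
by rewrite (mulrA (d x)%:C) signing_sqr// mul1r.
Qed.

Lemma signing_bounded d : signing d -> bounded_fun (fun x => (d x)%:C : R[i]).
Proof.
move=> ds; exists 1 => x; rewrite norm1_real.
by case: (ds x) => ->; rewrite ?normrN normr1.
Qed.

Lemma iter_generator_signed d G K t u k x : signing d -> degree_le G K ->
  bounded_fun u ->
  iter k (mxact (generator (signed d G) t)) u x =
  (d x)%:C * iter k (mxact (generator G t)) (sign_fun d u) x.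
Proof.
move=> ds GK ub; elim: k x => [|k IH] x.
  by rewrite /= /sign_fun mulrA signing_sqr// mul1r.
have SG := schur_bounded_generator t GK.
have dub : bounded_fun (sign_fun d u).
  exact: (bounded_fun_scale (signing_bounded ds) ub).
have fs := abs_summable_mxact x SG (iter_mxact_bounded k SG dub).
rewrite !iterS /mxact -csumZ//; congr csum; apply/funext => y.
rewrite -/(mxact _) IH /generator /adjmx /= !rmorphM /=.
(* The two signs at y meeting between consecutive factors D A D have product 1; it is inserted on
   the right so that [ring] closes the goal. *)
rewrite -[RHS]mul1r -(signing_sqr y ds).
by ring.
Qed.

(** D is its own inverse, so the outer D of D exp(itA) D moves to the target vector. *)
Lemma pst_signed d G K t u v x y : signing d -> degree_le G K ->
  fin_supp u -> fin_supp v -> u x != 0 -> v y != 0 ->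
  pst (signed d G) t u v <-> pst G t (sign_fun d u) (sign_fun d v).
Proof.
move=> ds GK uf vf ux vy.
have suf := fin_suppM (fun x => (d x)%:C) uf.
have svf := fin_suppM (fun x => (d x)%:C) vf.
have dux : sign_fun d u x != 0 by rewrite mulf_neq0 ?signing_neq0.
have dvy : sign_fun d v y != 0 by rewrite mulf_neq0 ?signing_neq0.
rewrite (pst_iff t (degree_le_signed ds GK) uf vf ux vy).
rewrite (pst_iff t GK suf svf dux dvy).
have E z : mxact (transition (signed d G) t) u z =
    (d z)%:C * mxact (transition G t) (sign_fun d u) z.
  apply: (expmx_transfer (schur_bounded_generator t (degree_le_signed ds GK))
    (schur_bounded_generator t GK) uf suf) => k.
  apply: (iter_generator_signed t k z ds GK).
  exact/abs_summable_bounded/fin_supp_abs_summable.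
split => -[g H]; exists g => z.
- by apply/(signing_mulE g _ _ z ds); rewrite -E.
- by rewrite E; have /(signing_mulE g _ (v z) z ds) := H z.
Qed.

End Signed.

Unset Implicit Arguments.
Set Strict Implicit.

(** Each clause is compared with transfer in H alone. The choice of D is read both as some D and as
    every D: the outcome does not depend on D, and an admissible D exists. In the last clause a = b
    would force [d (ord0, a)] to equal its own opposite, so no sign matrix would be admissible;
    hence the separate list under [a <> b]. *)
Theorem theorem6p1 (R : realType) (V : countType) (H : wgraph R V)
    (H_bounded : bounded_graph H) (a b : V) (n : nat) (n_ge1 : (1 <= n)%N)
    (tau : R) :
  let X2 := blowup 2 H in
  let s : R[i] := (Num.sqrt 2)^-1%:C in
  let plus (x : V) : 'I_2 * V -> R[i] :=
    s *: (ket R (ord0, x) + ket R (ord_max, x)) in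
  let minus (x : V) : 'I_2 * V -> R[i] :=
    s *: (ket R (ord0, x) - ket R (ord_max, x)) in
  let cond3 (d : 'I_2 * V -> R) :=
    [/\ signing d, d (ord0, a) = - d (ord_max, a)
      & d (ord0, b) = - d (ord_max, b)] in
  let cond4 (d : 'I_2 * V -> R) :=
    [/\ signing d, d (ord0, a) = - d (ord_max, a)
      & d (ord0, b) = d (ord_max, b)] in
  [<-> pst H tau (ket R a) (ket R b);
       pst (blowup n H) (tau / n%:R)
         (\sum_(j < n) ket R (j, a)) (\sum_(j < n) ket R (j, b));
       pst X2 (tau / 2) (plus a) (plus b);
       exists2 d, cond3 d & pst (signed d X2) (tau / 2) (minus a) (minus b);
       forall d, cond3 d -> pst (signed d X2) (tau / 2) (minus a) (minus b)]
  /\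
  (a <> b ->
   [<-> pst H tau (ket R a) (ket R b);
        exists2 d, cond4 d & pst (signed d X2) (tau / 2) (minus a) (plus b);
        forall d, cond4 d -> pst (signed d X2) (tau / 2) (minus a) (plus b)]).
Proof.
move=> X2 s plus minus cond3 cond4.
have [K HK] := bounded_graph_degree_le H_bounded.
have s0 : s != 0.
  by rewrite (fmorph_eq0 (real_complex R)) invr_eq0 sqrtr_eq0 -ltNge ltr0n.
have plusE x : plus x = s *: lift_ket R 2 x.
  rewrite lift_ketE big_ord_recl big_ord_recl big_ord0 addr0.
  by have -> : lift ord0 ord0 = ord_max :> 'I_2 by exact: val_inj.
(* The free scalars absorb the signs [d (ord0, a)] and [d (ord0, b)] that switching leaves on the
   plus states. *)
have X2_plus (s1 s2 : R[i]) : s1 != 0 -> s2 != 0 ->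
    pst X2 (tau / 2) (s1 *: plus a) (s2 *: plus b) <-> pst H tau (ket R a) (ket R b).
  move=> s10 s20; rewrite !plusE !scalerA.
  by apply: (pst_blowup _ _ _ _ HK) => //; rewrite mulf_neq0.
have fplus x : fin_supp (plus x).
  by rewrite plusE; apply: fin_suppZ; exact: fin_supp_lift_ket.
have ord2P (i : 'I_2) : i = ord0 \/ i = ord_max.
  by case: i => -[|[|//]] ilt; [left|right]; exact: val_inj.
have minus_val (x : V) i y :
    minus x (i, y) = s * ((y == x)%:R * (if i == ord0 then 1 else -1)).
  rewrite /minus scale_funE; congr (s * _).
  transitivity (ket R (ord0, x) (i, y) - ket R (ord_max : 'I_2, x) (i, y)) => //.
  rewrite /ket !xpair_eqE; case: (ord2P i) => -> /=.
    by rewrite mulr1 subr0.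
  by rewrite mulrN1 sub0r.
have plus_val (x : V) i y : plus x (i, y) = s * (y == x)%:R.
  by rewrite plusE scale_funE.
have plus0 x : plus x (ord0, x) != 0 by rewrite plus_val eqxx mulr1.
have minus0 x : minus x (ord0, x) != 0 by rewrite minus_val !eqxx !mulr1.
have fminus x : fin_supp (minus x).
  exists [:: (ord0, x); (ord_max, x)] => -[i y]; rewrite !inE minus_val !xpair_eqE.
  case: (eqVneq y x) => _; last by rewrite mulr0n mul0r mulr0.
  by case: (ord2P i) => ->; rewrite ?orbT.
have sign_minus (d : 'I_2 * V -> R) x : d (ord0, x) = - d (ord_max, x) ->
    sign_fun d (minus x) = (d (ord0, x))%:C *: plus x.
  move=> dx; apply/funext => -[i y]; rewrite /sign_fun scale_funE minus_val plus_val.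
  case: (eqVneq y x) => [->|_]; last by rewrite mulr0n mul0r !mulr0.
  case: (ord2P i) => -> /=; rewrite ?dx ?rmorphN /= mul1r !mulr1//.
  by rewrite mulrN1 mulrN mulNr.
have sign_plus (d : 'I_2 * V -> R) x : d (ord0, x) = d (ord_max, x) ->
    sign_fun d (plus x) = (d (ord0, x))%:C *: plus x.
  move=> dx; apply/funext => -[i y]; rewrite /sign_fun scale_funE plus_val.
  case: (eqVneq y x) => [->|_]; last by rewrite mulr0n !mulr0.
  by case: (ord2P i) => -> /=; rewrite ?dx.
have X2K : degree_le X2 (2%:R * K) := degree_le_blowup 2 HK.
have pst3 d : cond3 d -> pst (signed d X2) (tau / 2) (minus a) (minus b) <->
    pst H tau (ket R a) (ket R b).
  move=> [ds da db].
  rewrite (pst_signed _ ds X2K (fminus a) (fminus b) (minus0 a) (minus0 b)).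
  by rewrite sign_minus// sign_minus// X2_plus ?signing_neq0.
have pst4 d : cond4 d -> pst (signed d X2) (tau / 2) (minus a) (plus b) <->
    pst H tau (ket R a) (ket R b).
  move=> [ds da db].
  rewrite (pst_signed _ ds X2K (fminus a) (fplus b) (minus0 a) (plus0 b)).
  by rewrite sign_minus// sign_plus// X2_plus ?signing_neq0.
have ex3 : exists d, cond3 d.
  (* Opposite signs on the two copies meet the condition at all vertices at once, including when a =
     b. *)
  exists (fun p => if p.1 == ord0 then 1 else -1).
  by split => [p||] /=; rewrite ?eqxx ?opprK//; case: ifP => _; [left|right].
have pst1 : pst (blowup n H) (tau / n%:R)
    (\sum_(j < n) ket R (j, a)) (\sum_(j < n) ket R (j, b)) <->
    pst H tau (ket R a) (ket R b).
  rewrite -!lift_ketE -(scale1r (lift_ket R n a)) -(scale1r (lift_ket R n b)).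
  by apply: (pst_blowup _ _ _ _ HK); rewrite ?oner_neq0.
have pst2 : pst X2 (tau / 2) (plus a) (plus b) <-> pst H tau (ket R a) (ket R b).
  by rewrite -(scale1r (plus a)) -(scale1r (plus b)); apply: X2_plus; rewrite oner_neq0.
split.
  tfae.
  - by move=> /pst1.
  - by move=> /pst1 /pst2.
  - by move=> /pst2 h; have [d d3] := ex3; exists d => //; apply/pst3.
  - by move=> [d d3 /(pst3 d d3) h] d' d'3; apply/pst3.
  - by move=> h; have [d d3] := ex3; apply/(pst3 d d3)/h.
move=> ab.
have ex4 : exists d, cond4 d.
  (* Only the second copy of a is flipped; as b differs from a, both copies of b keep the sign 1. *)
  exists (fun p => if p == (ord_max, a) then -1 else 1).
  have nba : b == a = false by apply/eqP => /esym.
  split => [p||] /=; rewrite ?xpair_eqE ?eqxx ?nba ?andbF ?opprK//.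
  by case: ifP => _; [right|left].
tfae.
- by move=> h; have [d d4] := ex4; exists d => //; apply/pst4.
- by move=> [d d4 /(pst4 d d4) h] d' d'4; apply/pst4.
- by move=> h; have [d d4] := ex4; apply/(pst4 d d4)/h.
Qed.
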